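(* Let $m\ge 2$ and let $n_1,\dots,n_m\ge 1$ be integers, and put $n=\sum_{i=1}^m n_i$. Let $A$ be the adjacency matrix of the complete $m$-uniform $m$-partite hypergraph $K^m_{n_1,n_2,\dots,n_m}$. Then the characteristic polynomial $\det(xI_n-A)$ of $K^m_{n_1,\dots,n_m}$ equals $$x^{n-m}\Bigg(x^m-\sum_{i=2}^m\frac{i-1}{(m-1)^i}\,\sigma_i(s_1,s_2,\dots,s_m)\,x^{m-i}\Bigg),$$ where $s_i=\prod_{j=1,\,j\ne i}^m n_j$ and $\sigma_i(s_1,\dots,s_m)=\sum_{1\le j_1<j_2<\dots<j_i\le m}s_{j_1}s_{j_2}\cdots s_{j_i}$.
   Context: $K^m_{n_1,\dots,n_m}$ is the (unweighted) hypergraph whose vertex set is a disjoint union $V=V_1\cup\dots\cup V_m$ with $|V_i|=n_i$, and whose edges are all subsets $e\subseteq V$ with $|e|=m$ and $|e\cap V_i|=1$ for every $i$. The adjacency matrix of an unweighted $m$-uniform hypergraph is the matrix indexed by its vertices with zero diagonal and with $(i,j)$ entry, for $i\ne j$, equal to $\frac{1}{m-1}$ times the number of edges containing both $i$ and $j$. *)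

(* Defs.v *)
From mathcomp Require Export all_boot all_order all_algebra.
From mathcomp Require Export mpoly.

Set Implicit Arguments.
Unset Strict Implicit.
Unset Printing Implicit Defensive.

Import GRing.Theory Num.Theory.

Local Open Scope ring_scope.

Record uniform_hypergraph (m : nat) := UniformHypergraph {
  hvertex : finType;
  hedge : {set {set hvertex}};
  hedge_card : {in hedge, forall e : {set hvertex}, #|e| = m} }.

(* Rows and columns are numbered by the enumeration of the vertex type. *)
Definition adjacency (R : fieldType) (m : nat) (H : uniform_hypergraph m) :
    'M[R]_#|hvertex H| :=
  \matrix_(a, b)
    let u := enum_val a in let v := enum_val b in
    if u == v then 0
    else #|[set e in hedge H | (u \in e) && (v \in e)]|%:R / (m.-1)%:R.

Section CompleteMultipartite.

Variables (m : nat) (n : 'I_m -> nat).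

(* The disjoint union of the parts: a vertex is a pair (i, k), with k < n i. *)
Definition multipartite_vertex : finType := {i : 'I_m & 'I_(n i)}.

Definition multipartite_part (i : 'I_m) : {set multipartite_vertex} :=
  [set v | tag v == i].

Definition multipartite_edges : {set {set multipartite_vertex}} :=
  [set e : {set multipartite_vertex} | (#|e| == m) &&
           [forall i, #|e :&: multipartite_part i| == 1%N]].

Lemma multipartite_edges_card :
  {in multipartite_edges, forall e : {set multipartite_vertex}, #|e| = m}.
Proof. by move=> e; rewrite inE => /andP[/eqP]. Qed.

Definition complete_multipartite : uniform_hypergraph m :=
  UniformHypergraph multipartite_edges_card.

End CompleteMultipartite.

(* Main.v *)
Require Import Defs.
Set Implicit Arguments.
Unset Strict Implicit.
Unset Printing Implicit Defensive.

Import GRing.Theory Num.Theory.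
Local Open Scope ring_scope.

(** The adjacency matrix A of the complete m-partite hypergraph only depends on
    the parts of its two indices, so it has rank at most m and factors as
    A = E W E^T, where E is the vertex-by-part incidence matrix and W is the
    m x m matrix of weights between parts ([adjacency_factor]).  Here
    W i j = c * prod_(k <> i, j) n_k off the diagonal, with c = 1 / (m - 1):
    an edge is a choice of one vertex in each part, so the number of edges
    through two given vertices of parts i <> j is the product of the sizes of
    the other parts ([card_edges_through]).

    Since X^q chi(P Q) = X^p chi(Q P) for P of size p x q and Q of size q x p
    ([char_poly_mulmxC]), it suffices to know the characteristic polynomial of
    the m x m matrix B = W E^T E = W diag(n_1, ..., n_m).  As
    n_j * prod_(k <> i, j) n_k = s_i, all off-diagonal entries of the i-th row of
    B are equal to c s_i, while the diagonal vanishes.  So X - B is the diagonal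
    matrix with entries X + c s_i minus the rank one matrix with constant rows
    c s_i, and the matrix determinant lemma ([det_diag_sub_rank1]) gives

      chi(B) = prod_i (X + c s_i) - sum_i c s_i prod_(j <> i) (X + c s_j).

    Expand both terms over the sets J of indices at which c s_j is selected.
    The monomial of J occurs once in the first product and #|J| times in the
    sum, hence with total coefficient 1 - #|J| ([prod_add_sub_sum]).  Grouping
    the sets J by cardinality k yields the terms
    (1 - k) c^k sigma_k(s) X^(m - k): the one for k = 0 is X^m, the one for
    k = 1 vanishes, and the others form the announced sum. *)

(** * Determinants of low-rank perturbations *)

(** The identity block clears b by column operations.  The two identities that
    follow compare this value with the one obtained by clearing b by row
    operations instead. *)
Lemma det_block_mx1 (R : comNzRingType) p q (D : 'M[R]_p) (a : 'M[R]_(p, q))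
    (b : 'M[R]_(q, p)) :
  \det (block_mx D a b 1%:M) = \det (D - a *m b).
Proof.
have -> : block_mx D a b 1%:M =
    block_mx (D - a *m b) a 0 1%:M *m block_mx 1%:M 0 b 1%:M.
  by rewrite mulmx_block !mulmx0 !mul0mx !mulmx1 !mul1mx subrK !add0r.
by rewrite det_mulmx det_ublock det_lblock !det1 !mulr1.
Qed.

(** In the block matrix with rows (X, a) and (b, 1), clearing b by row
    operations requires scaling the last q rows by X: this is the factor X^q,
    and X^p is the determinant of the corner X. *)
Lemma char_poly_mulmxC (R : comNzRingType) p q (A : 'M[R]_(p, q))
    (B : 'M[R]_(q, p)) :
  'X^q * char_poly (A *m B) = 'X^p * char_poly (B *m A).
Proof.
rewrite /char_poly /char_poly_mx !map_mxM.
set a := map_mx _ A; set b := map_mx _ B.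
transitivity (\det (block_mx 1%:M 0 (- b) 'X%:M *m block_mx 'X%:M a b 1%:M)).
  by rewrite det_mulmx det_lblock det1 det_scalar mul1r det_block_mx1.
rewrite mulmx_block !mul1mx !mul0mx !mulmx1 !addr0 !mulNmx scalar_mxC addNr.
by rewrite det_ublock det_scalar addrC.
Qed.

(** The matrix Q of the proof is the adjugate of the diagonal matrix D: with
    it, the last row of the block matrix with rows (D, u) and (v, 1) is cleared
    without inverting D, at the price of a factor det D, which can be cancelled
    because no d i vanishes. *)
Lemma det_diag_sub_rank1 (R : idomainType) n (d u v : 'I_n -> R) :
    (forall i, d i != 0) ->
  \det (\matrix_(i, j) (d i *+ (i == j) - u i * v j)) =
  \prod_i d i - \sum_i u i * v i * \prod_(j | j != i) d j.
Proof.
move=> d_neq0; set P := \prod_i d i.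
have P_neq0 : P != 0 by apply/prodf_neq0.
pose D := diag_mx (\row_i d i); pose U := \col_i u i; pose V := \row_i v i.
pose Q := diag_mx (\row_i \prod_(j | j != i) d j).
have detD : \det D = P by rewrite det_diag; apply: eq_bigr => i _; rewrite mxE.
have QD : Q *m D = P%:M.
  rewrite mulmx_diag; apply/matrixP=> i j; rewrite !mxE.
  by congr (_ *+ _); rewrite mulrC /P [RHS](bigD1 i).
have -> : \matrix_(i, j) (d i *+ (i == j) - u i * v j) = D - U *m V.
  by apply/matrixP => i j; rewrite !mxE big_ord1 !mxE.
apply: (mulfI P_neq0); rewrite -det_block_mx1.
transitivity (\det (block_mx 1%:M 0 (- (V *m Q)) P%:M *m
                   block_mx D U V 1%:M)).
  by rewrite det_mulmx det_lblock det1 mul1r det_scalar1.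
rewrite mulmx_block !mul1mx !mul0mx !addr0 mulmx1 !mulNmx -(mulmxA V Q D) QD.
rewrite scalar_mxC addNr det_ublock detD; congr (_ * _).
rewrite [_ + _]mx11_scalar det_scalar1 !mxE eqxx addrC; congr (_ - _).
apply: eq_bigr => i _; rewrite mul_mx_diag !mxE.
by rewrite mulrC mulrA.
Qed.

(** * Expansion into elementary symmetric functions *)

(** The monomial attached to J occurs once in the product and, for each i in
    J, once in the i-th summand, which chooses t i at i. *)
Lemma prod_add_sub_sum (R : comNzRingType) n (x : R) (t : 'I_n -> R) :
  \prod_i (t i + x) - \sum_i t i * \prod_(j | j != i) (t j + x) =
  \sum_(J : {set 'I_n}) (1 - #|J|%:R) * (\prod_(i in J) t i * x ^+ (n - #|J|)).
Proof.
have termE (J : {set 'I_n}) :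
    \prod_i (if i \in J then t i else x) = \prod_(i in J) t i * x ^+ (n - #|J|).
  rewrite (bigID (mem J)) /=; congr (_ * _).
    by apply: eq_bigr => i ->.
  rewrite (eq_bigr (fun=> x)) => [|i /negbTE -> //].
  rewrite prodr_const; congr (x ^+ _).
  by rewrite -[X in (X - _)%N]card_ord -(cardC (mem J)) addKn.
have subsumE i : t i * \prod_(j | j != i) (t j + x) =
    \sum_(J : {set 'I_n} | i \in J) (\prod_(i in J) t i * x ^+ (n - #|J|)).
  (* Replacing x by 0 at position i forces the choice of t i there. *)
  transitivity (\prod_j (t j + (if j == i then 0 else x))).
    rewrite [RHS](bigD1 i) //= eqxx addr0; congr (_ * _).
    by apply: eq_bigr => j /negbTE ->.
  rewrite bigA_distr [RHS]big_mkcond; apply: eq_bigr => J _.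
  case: ifPn => iJ.
    rewrite -termE; apply: eq_bigr => j _.
    by case: (altP (j =P i)) => [->|//]; rewrite iJ.
  by rewrite (bigD1 i) //= (negbTE iJ) eqxx mul0r.
rewrite bigA_distr (eq_bigr _ (fun J _ => termE J)).
rewrite (eq_bigr _ (fun i _ => subsumE i)).
rewrite (exchange_big_dep xpredT) //= -sumrB; apply: eq_bigr => J _.
by rewrite sumr_const mulrBl mul1r mulr_natl.
Qed.

Lemma sum_set_mesym (R : comNzRingType) m (c : R) (s : 'I_m -> R)
    (f : nat -> R) :
  \sum_(J : {set 'I_m})
     (f #|J|)%:P * (\prod_(i in J) (c * s i)%:P * 'X ^+ (m - #|J|)) =
  \sum_(0 <= k < m.+1) (f k * (c ^+ k * (mesym m R k).@[s])) *: 'X^(m - k).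
Proof.
rewrite big_mkord.
rewrite (partition_big (fun J : {set 'I_m} => inord #|J| : 'I_m.+1) xpredT) //=.
apply: eq_bigr => k _.
rewrite (_ : _.@[s] =
             \sum_(J : {set 'I_m} | #|J| == k) \prod_(i in J) s i); last first.
  rewrite raddf_sum /=; apply: eq_bigr => J _.
  by rewrite rmorph_prod; apply: eq_bigr => i _; rewrite /= mevalXU.
rewrite !mulr_sumr scaler_suml; apply: eq_big => J.
  by rewrite -val_eqE /= inordK // ltnS -[X in (_ <= X)%N]card_ord max_card.
rewrite -val_eqE /= inordK => [/eqP Jk|]; last first.
  by rewrite ltnS -[X in (_ <= X)%N]card_ord max_card.
rewrite -rmorph_prod big_split prodr_const Jk mulrA -rmorphM.
by rewrite mul_polyC.
Qed.

(** * Edges through two vertices *)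

Lemma card_multipartite_vertex m (n : 'I_m -> nat) :
  #|multipartite_vertex n| = (\sum_(i < m) n i)%N.
Proof.
rewrite card_tagged sumnE big_map big_enum.
by apply: eq_bigr => i _; rewrite card_ord.
Qed.

Lemma card_multipartite_part m (n : 'I_m -> nat) i :
  #|multipartite_part n i| = n i.
Proof.
pose f (k : 'I_(n i)) : multipartite_vertex n := Tagged (fun j => 'I_(n j)) k.
have f_inj : injective f by move=> k l /eqP; rewrite eq_Tagged => /eqP.
rewrite -[RHS]card_ord -(card_imset predT f_inj); apply: eq_card => v.
rewrite inE; apply/eqP/imsetP => [|[k _ ->] //].
by case: v => j k /= ji; subst j; exists k.
Qed.

Lemma multipartite_edge_inter1 m (n : 'I_m -> nat) e i :
  e \in multipartite_edges n -> #|e :&: multipartite_part n i| = 1%N.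
Proof. by rewrite inE => /andP[_ /forallP/(_ i)/eqP]. Qed.

Lemma multipartite_edge_tag_inj m (n : 'I_m -> nat) e :
  e \in multipartite_edges n -> {in e &, injective tag}.
Proof.
move=> eE u v ue ve uv.
have /eqP/cards1P[w eiw] := multipartite_edge_inter1 (tag u) eE.
have /set1P -> : u \in [set w] by rewrite -eiw !inE ue eqxx.
by have /set1P -> : v \in [set w] by rewrite -eiw !inE ve uv eqxx.
Qed.

(** Edges are the images of the sections of the map [tag], that is, of the
    choices of one vertex in each part.  Sections are kept as functions with
    values in the whole vertex type so that they can be counted as a [family]
    of non-dependent finite functions. *)
Lemma image_section_edge m (n : 'I_m -> nat)
    (f : {ffun 'I_m -> multipartite_vertex n}) :
  (forall i, tag (f i) = i) -> f @: 'I_m \in multipartite_edges n.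
Proof.
move=> tagf; have f_inj : injective f by apply: can_inj tagf.
rewrite inE card_imset // card_ord eqxx; apply/forallP=> i; apply/cards1P.
exists (f i); apply/setP => x; rewrite !inE.
apply/andP/eqP => [[/imsetP[j _ ->] /eqP]|->]; first by rewrite tagf => ->.
by rewrite tagf eqxx imset_f.
Qed.

Lemma edge_image_section m (n : 'I_m -> nat) e :
  e \in multipartite_edges n ->
  exists2 f : {ffun 'I_m -> multipartite_vertex n},
    forall i, tag (f i) = i & e = f @: 'I_m.
Proof.
move=> eE; have /fin_all_exists[g gP] (i : 'I_m) :
    exists x, x \in e :&: multipartite_part n i.
  by apply/set0Pn; rewrite -card_gt0 (multipartite_edge_inter1 i eE).
have tagf i : tag ([ffun i => g i] i) = i.
  by rewrite ffunE; have := gP i; rewrite !inE => /andP[_ /eqP].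
exists [ffun i => g i] => //; apply/esym/eqP; rewrite eqEcard; apply/andP; split.
  by apply/subsetP => _ /imsetP[i _ ->]; rewrite ffunE; case/setIP: (gP i).
rewrite card_imset ?card_ord; last by apply: can_inj tagf.
by rewrite (multipartite_edges_card eE).
Qed.

(** The edges through u and v correspond bijectively to the sections that take
    the values u and v at the parts of u and v and are free elsewhere. *)
Lemma card_edges_through m (n : 'I_m -> nat) (u v : multipartite_vertex n) :
    tag u != tag v ->
  #|[set e in multipartite_edges n | (u \in e) && (v \in e)]| =
  (\prod_(k < m | (k != tag u) && (k != tag v)) n k)%N.
Proof.
move=> uv.
pose F (i : 'I_m) : pred (multipartite_vertex n) := [pred x | (tag x == i) &&
  ((i == tag u) ==> (x == u)) && ((i == tag v) ==> (x == v))].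
have FP (f : {ffun 'I_m -> multipartite_vertex n}) :
    reflect [/\ forall i, tag (f i) = i, f (tag u) = u & f (tag v) = v]
    (f \in family F).
  apply: (iffP familyP) => [fF|[tagf fu fv] i].
    split=> [i||]; have := fF _.
    - by move=> /(_ i); rewrite inE => /andP[/andP[/eqP]].
    - move=> /(_ (tag u)); rewrite inE => /andP[/andP[_]].
      by rewrite eqxx => /eqP.
    - by move=> /(_ (tag v)); rewrite inE => /andP[_]; rewrite eqxx => /eqP.
  rewrite inE tagf eqxx /=.
  by apply/andP; split; apply/implyP => /eqP ->; apply/eqP.
have mem_image (f : {ffun 'I_m -> multipartite_vertex n}) w :
    (forall i, tag (f i) = i) ->
    (w \in f @: 'I_m) = (f (tag w) == w).
  move=> tagf; apply/imsetP/eqP => [[i _ ->]|<-]; first by rewrite tagf.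
  by exists (tag w).
have -> : [set e in multipartite_edges n | (u \in e) && (v \in e)] =
    (fun f : {ffun 'I_m -> multipartite_vertex n} => f @: 'I_m) @: family F.
  apply/setP => e; rewrite inE.
  apply/andP/imsetP => [[eE]|[f /FP[tagf fu fv] ->]].
    have [f tagf ->] := edge_image_section eE.
    rewrite !mem_image // => /andP[/eqP fu /eqP fv].
    by exists f => //; apply/FP.
  by rewrite image_section_edge // !mem_image // fu fv !eqxx.
rewrite card_in_imset => [|f g /FP[tagf _ _] /FP[tagg _ _] fg]; last first.
  apply/ffunP => i; have : f i \in g @: 'I_m by rewrite -fg imset_f.
  by rewrite mem_image // tagf => /eqP.
rewrite card_family foldrE big_map big_enum [RHS]big_mkcond /=.
apply: eq_bigr => i _.
have [-> | iu] /= := altP (i =P tag u).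
  rewrite -(card1 u); apply: eq_card => x.
  rewrite !inE (negbTE uv) eqxx andbT.
  by rewrite andb_idl // => /eqP ->.
have [-> | iv] /= := altP (i =P tag v).
  rewrite -(card1 v); apply: eq_card => x.
  rewrite !inE eqxx [tag v == _]eq_sym (negbTE uv) andbT.
  by rewrite andb_idl // => /eqP ->.
rewrite -card_multipartite_part; apply: eq_card => x.
by rewrite !inE (negbTE iu) (negbTE iv) !andbT.
Qed.

(** * Reduction to a matrix indexed by the parts *)

Section PartQuotient.

Variables (R : fieldType) (m : nat) (n : 'I_m -> nat).

Local Notation A := (adjacency R (complete_multipartite n)).
Local Notation c := ((m.-1)%:R^-1 : R).
Local Notation s := (fun i : 'I_m => ((\prod_(j < m | j != i) n j)%N)%:R : R).

Definition part_incidence : 'M[R]_(#|multipartite_vertex n|, m) :=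
  \matrix_(a, i) (tag (enum_val a) == i)%:R.

Definition part_weight : 'M[R]_m :=
  \matrix_(i, j) if i == j then 0 else
    (\prod_(k < m | (k != i) && (k != j)) n k)%N%:R * c.

Lemma adjacency_factor :
  A = part_incidence *m (part_weight *m part_incidence^T).
Proof.
have pick_part p (M : 'M[R]_(m, p)) a j :
    (part_incidence *m M) a j = M (tag (enum_val a)) j.
  rewrite mxE (bigD1 (tag (enum_val a))) //= mxE eqxx mul1r big1 ?addr0 // => i.
  by rewrite mxE eq_sym => /negbTE ->; rewrite mul0r.
apply/matrixP => a b; rewrite pick_part.
rewrite -[part_weight]trmxK -trmx_mul mxE [RHS]mxE pick_part !mxE.
set u := enum_val a; set v := enum_val b.
have [-> | uv] /= := eqVneq u v; first by rewrite !eqxx.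
rewrite (negbTE uv); case: ifPn => [/eqP tuv | tuv];
  last by rewrite card_edges_through.
(* Distinct vertices in the same part lie on no common edge. *)
rewrite (_ : [set e in _ | _] = set0) ?cards0 ?mul0r //.
apply/setP => e; rewrite in_set0 in_set; apply/negP => /andP[eE /andP[ue ve]].
by case/eqP: uv; exact: (multipartite_edge_tag_inj eE ue ve tuv).
Qed.

Lemma part_incidence_gram :
  part_incidence^T *m part_incidence = diag_mx (\row_i (n i)%:R).
Proof.
apply/matrixP => i j; rewrite !mxE.
transitivity
  (\sum_(x : multipartite_vertex n) ((tag x == i) && (tag x == j))%:R : R).
  rewrite [RHS]big_enum_val; apply: eq_bigr => a _.
  by rewrite !mxE -natrM mulnb.
rewrite -natr_sum -big_mkcond /= sum1_card.
have [<- | ij] := eqVneq i j.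
  rewrite -[in RHS]card_multipartite_part; congr (_ %:R).
  by apply: eq_card => x; rewrite !inE /in_mem /= andbb.
rewrite eq_card0 // => x; rewrite /in_mem /=.
by apply/negP => /andP[/eqP -> /eqP /eqP]; rewrite (negbTE ij).
Qed.

(** The factor n_j of the Gram matrix completes the product over k <> i, j to
    s_i, which makes the off-diagonal entries of a row equal. *)
Lemma quotient_entry i j :
  (part_weight *m part_incidence^T *m part_incidence) i j =
  if i == j then 0 else c * s i.
Proof.
rewrite -mulmxA part_incidence_gram mul_mx_diag !mxE.
have [|ij] := eqVneq i j; first by rewrite mul0r.
rewrite mulrAC mulrC; congr (_ * _).
by rewrite -natrM [in RHS](bigD1 j) 1?eq_sym //= mulnC.
Qed.

(** Let B be the matrix on the left.  Then X - B has diagonal entries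
    X = (X + c s_i) - c s_i, so it is a diagonal matrix minus the
    product of the column (c s_i) by a row of ones. *)
Lemma char_poly_quotient :
  char_poly (part_weight *m part_incidence^T *m part_incidence) =
  \prod_i ((c * s i)%:P + 'X) -
  \sum_i (c * s i)%:P * \prod_(j | j != i) ((c * s j)%:P + 'X).
Proof.
have dneq0 i : (c * s i)%:P + 'X != 0.
  by rewrite addrC -size_poly_eq0 size_XaddC.
have := det_diag_sub_rank1 (fun i => (c * s i)%:P) (fun=> 1) dneq0.
under [X in _ = _ - X]eq_bigr do rewrite mulr1.
move: (part_weight *m _ *m _) quotient_entry => B BE <-.
congr (\det _); apply/matrixP => i j.
rewrite !mxE BE mulr1; have [_|_] := eqVneq i j.
  by rewrite addrAC subrr add0r subr0.
by [].
Qed.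

End PartQuotient.

(** * The characteristic polynomial *)

Theorem proposition2 (R : realFieldType) (m : nat) (n : 'I_m -> nat)
    (hm : (2 <= m)%N) (hn : forall i : 'I_m, (1 <= n i)%N) :
  let N := (\sum_(i < m) n i)%N in
  let s := fun i : 'I_m => ((\prod_(j < m | j != i) n j)%N)%:R : R in
  char_poly (adjacency R (complete_multipartite n)) =
    'X^(N - m) *
    ('X^m - \sum_(2 <= i < m.+1)
        ((i.-1)%:R / (m.-1)%:R ^+ i * (mesym m R i).@[s]) *: 'X^(m - i)).
Proof.
move=> N s.
have mN : (m <= N)%N.
  by rewrite -[X in (X <= _)%N]card_ord -sum1_card; apply: leq_sum.
have Xm_neq0 : 'X^m != 0 :> {poly R} by rewrite -size_poly_eq0 size_polyXn.
apply: (mulfI Xm_neq0).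
rewrite adjacency_factor char_poly_mulmxC char_poly_quotient.
rewrite card_multipartite_vertex -/N.
rewrite mulrA -exprD subnKC //; congr (_ * _).
rewrite prod_add_sub_sum.
rewrite (eq_bigr (fun J : {set 'I_m} => (1 - #|J|%:R)%:P *
    (\prod_(i in J) ((m.-1)%:R^-1 * s i)%:P * 'X ^+ (m - #|J|))))
  => [|J _]; last by rewrite polyCB polyC1 polyC_natr.
rewrite (sum_set_mesym _ _ (fun k => 1 - k%:R)).
(* The terms of cardinality 0 and 1 are X^m and 0. *)
rewrite big_ltn // big_ltn; last exact: ltnW.
rewrite mesym0E meval1 subn0 subr0 expr0 !mul1r scale1r subrr mul0r scale0r add0r.
rewrite -sumrN; congr (_ + _); apply: eq_big_nat => k /andP[k2 _].
rewrite -scaleNr exprVn; congr (_ *: _).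
have -> : 1 - k%:R = - (k.-1)%:R :> R.
  by rewrite -[in LHS](prednK (ltnW k2)) -natr1 opprD addrCA subrr addr0.
by rewrite mulrA -!mulNr.
Qed.
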